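(* Let $n\ge 1$, let $d_1,\dots,d_n$ be positive integers, $D=d_1d_2\cdots d_n$, and let $\Sigma$ be a simplicial complex on the vertex set $[n]$ with $\{i\}\in\Sigma$ for all $i\in[n]$. Then the marginal independence variety $\mathcal{M}_\Sigma$ (the projective variety in $\mathbb{P}^{D-1}$, equivalently its affine cone in $\mathbb{R}^D$) is irreducible, and its prime ideal, written in the Möbius coordinates $q_{\ell_1\cdots\ell_n}$, is toric. This prime ideal is obtained from the Segre ideal $J_{\mathcal S}\subset\mathbb{R}[Q]$ by eliminating all irrelevant Möbius coordinates; that is, it is generated by $J_{\mathcal S}\cap\mathbb{R}[\,q_{\ell_1\cdots\ell_n} : q_{\ell_1\cdots\ell_n}\text{ relevant}\,]$. Moreover, viewed modulo the linear space $\mathcal{L}_\Sigma$ (that is, after projecting to the relevant Möbius coordinates), $\mathcal{M}_\Sigma$ is the toric variety given by the monomial parametrization $$q_{\ell_1\ell_2\cdots\ell_n}\;\mapsto\;\lambda\prod_{j\,:\,\ell_j\in[d_j-1]}\theta^{(j)}_{\ell_j},$$ where $q_{\ell_1\cdots\ell_n}$ runs over all relevant Möbius coordinates and $\lambda$, $\theta^{(j)}_k$ ($j\in[n]$, $k\in[d_j-1]$) are free parameters.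
   Context: Notation: $[m]=\{1,\dots,m\}$. $\mathbb{R}^D$ is the space of real tensors $P=(p_{i_1\cdots i_n})$ of format $d_1\times\cdots\times d_n$, with associated projective space $\mathbb{P}^{D-1}$. $\Delta_{D-1}$ is the probability simplex of tensors with nonnegative entries summing to $1$. Marginalization: for $\sigma\subseteq[n]$, $P_\sigma$ is the tensor with $\prod_{i\in\sigma}d_i$ entries obtained from $P$ by summing out all indices not in $\sigma$. An index $+$ in position $j$ means summation over all states in $[d_j]$ at that position, e.g. $p_{+jk}=\sum_i p_{ijk}$. Marginal independence model: $\mathcal{M}_\Sigma\cap\Delta_{D-1}$ is the set of distributions $P\in\Delta_{D-1}$ such that $P_\sigma$ has rank one for every $\sigma\in\Sigma$. The variety $\mathcal{M}_\Sigma$ is the Zariski closure of this set in $\mathbb{P}^{D-1}$, identified with its affine cone in $\mathbb{R}^D$. Möbius coordinates: for $\ell_j\in[d_j-1]\cup\{+\}$, the coordinate $q_{\ell_1\cdots\ell_n}$ is the linear form $p_{\ell_1\cdots\ell_n}$ in the entries of $P$ (with $+$ meaning summation). These $D$ linear forms are a system of linear coordinates on $\mathbb{R}^D$; $\mathbb{R}[Q]$ is the polynomial ring in them. The coordinate $q_{\ell_1\cdots\ell_n}$ is called relevant if $\{j:\ell_j\in[d_j-1]\}$ (equivalently $\{j : \ell_j\neq +\}$) is a face of $\Sigma$, and irrelevant otherwise. $\mathcal{L}_\Sigma\subset\mathbb{R}^D$ is the linear subspace of tensors $P$ with $P_\sigma=0$ for all $\sigma\in\Sigma$; equivalently, the common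 zero set of all relevant Möbius coordinates. Segre ideals: $I_{\mathcal S}\subset\mathbb{R}[P]=\mathbb{R}[p_{i_1\cdots i_n}]$ is the homogeneous prime ideal of the Segre variety $\mathcal S\subset\mathbb{R}^D$ of tensors of rank at most one (generated by the $2\times2$ minors of all flattenings). $J_{\mathcal S}\subset\mathbb{R}[Q]$ is the ideal obtained from $I_{\mathcal S}$ by renaming variables: each $p_{i_1\cdots i_n}$ is replaced by the $q$-variable whose index is obtained from $(i_1,\dots,i_n)$ by replacing each $i_j=d_j$ by $+$. A prime ideal is toric if it is the kernel of a ring homomorphism sending variables to monomials; the toric variety given by a monomial parametrization is the Zariski closure of its image. An ideal of the polynomial ring in the relevant coordinates is identified with its extension to $\mathbb{R}[Q]$. *)

(* Defs.v *)
From mathcomp Require Import all_boot all_order all_algebra.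
From mathcomp Require Import ring_quotient.
From mathcomp Require Import boolp classical_sets reals.
From mathcomp Require Import mpoly.

Set Implicit Arguments.
Unset Strict Implicit.
Unset Printing Implicit Defensive.

Import GRing.Theory.

Local Open Scope classical_set_scope.
Local Open Scope ring_scope.

Section Varieties.
Variables (R : realType) (T : finType).

Notation poly_ring := {mpoly R[#|T|]}.
Notation point := {ffun T -> R}.

Definition pvar (t : T) : poly_ring := 'X_(enum_rank t).

Definition peval (f : poly_ring) (P : point) : R :=
  f.@[fun i => P (enum_val i)].

(* The R-algebra morphism with [pvar t |-> h t]. *)
Definition psubst (k : nat) (h : T -> {mpoly R[k]}) (f : poly_ring) :
    {mpoly R[k]} :=
  f \mPo [tuple h (enum_val i) | i < #|T|].

Definition homogeneous (f : poly_ring) : Prop :=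
  exists k : nat, f \is k.-homog.

Definition zeros (F : set poly_ring) : set point :=
  [set P | forall f, F f -> peval f P = 0].

Definition vanishing (X : set point) : set poly_ring :=
  [set f | forall P, X P -> peval f P = 0].

Definition zariski_closed (X : set point) : Prop :=
  exists F : set poly_ring, X = zeros F.

Definition zariski_closure (X : set point) : set point := zeros (vanishing X).

(* Subsets of the projective space are represented by the sets of their
   homogeneous coordinate vectors, i.e. by scaling-invariant sets of nonzero
   points. *)
Definition proj_zeros (F : set poly_ring) : set point :=
  [set P | P <> 0 /\ forall f, F f -> homogeneous f -> peval f P = 0].

Definition proj_closed (X : set point) : Prop :=
  exists F : set poly_ring, X = proj_zeros F.

Definition proj_closure (X : set point) : set point :=
  proj_zeros (vanishing X).

Definition affine_cone (X : set point) : set point := X `|` [set 0].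

(* Irreducibility for the topology whose closed sets are given by [closed]. *)
Definition irreducible_for (closed : set point -> Prop) (X : set point) : Prop :=
  X !=set0 /\
  forall A B, closed A -> closed B -> X `<=` A `|` B -> X `<=` A \/ X `<=` B.

Definition prime_ideal (I : set poly_ring) : Prop :=
  idealr_closed (mem I) /\ prime_idealr_closed (mem I).

Definition toric_ideal (I : set poly_ring) : Prop :=
  prime_ideal I /\
  exists (k : nat) (a : T -> 'X_{1..k}),
    I = [set f | psubst (fun t => 'X_[a t]) f = 0].

Definition ideal_generated (G : set poly_ring) : set poly_ring :=
  [set f | exists2 s : seq (poly_ring * poly_ring),
     (forall x, x \in s -> G x.2) & f = \sum_(x <- s) x.1 * x.2].

(* [f] lies in the subring generated by the variables [pvar t] with [A t]. *)
Definition involves_only (A : pred T) (f : poly_ring) : Prop :=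
  forall m, m \in msupp f -> forall t, m (enum_rank t) != 0%N -> A t.

End Varieties.

Section Tensors.
Variables (R : realType) (J : finType) (d : J -> nat).

Definition mindex := {dffun forall j : J, 'I_(d j)}.

Definition tensor := {ffun mindex -> R}.

(* The scalar [c] makes the definition correct for tensors of order 0 (scalars)
   as well; for J nonempty it can be absorbed in one of the vectors. *)
Definition rank_le1 (P : tensor) : Prop :=
  exists (c : R) (v : forall j : J, 'I_(d j) -> R),
    forall i : mindex, P i = c * \prod_(j : J) v j (i j).

Definition rank_one (P : tensor) : Prop := P <> 0 /\ rank_le1 P.

Definition simplex : set tensor :=
  [set P | (forall i, 0 <= P i) /\ \sum_i P i = 1].

Definition segre_ideal : set {mpoly R[#|mindex|]} :=
  vanishing [set P : tensor | rank_le1 P].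

End Tensors.

Section MarginalIndependence.
Variables (R : realType) (n : nat) (d : 'I_n -> nat).

Definition simplicial_complex (Sigma : {set {set 'I_n}}) : Prop :=
  forall s t : {set 'I_n}, s \in Sigma -> t \subset s -> t \in Sigma.

Definition marginal (P : tensor R d) (s : {set 'I_n}) :
    tensor R (fun j : {j | j \in s} => d (val j)) :=
  [ffun a : mindex (fun j : {j | j \in s} => d (val j)) =>
     \sum_(i : mindex d |
        [forall j : {j | j \in s}, i (val j) == a j]) P i].

Definition independence_model (Sigma : {set {set 'I_n}}) : set (tensor R d) :=
  [set P | simplex P /\ forall s, s \in Sigma -> rank_one (marginal P s)].

Definition independence_variety (Sigma : {set {set 'I_n}}) : set (tensor R d) :=
  proj_closure (independence_model Sigma).

(* States are numbered from 0, so [d j - 1] is the nat range of ['I_(d j).-1] and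
   the last state is [(d j).-1]; [None] stands for the symbol +. *)
Definition qindex := {dffun forall j : 'I_n, option 'I_(d j).-1}.

Definition refines (i : mindex d) (l : qindex) : bool :=
  [forall j, if l j is Some k then val (i j) == val k else true].

Definition moebius_form (l : qindex) : {mpoly R[#|mindex d|]} :=
  \sum_(i : mindex d | refines i l) pvar R i.

Definition moebius_coord (P : tensor R d) (l : qindex) : R :=
  \sum_(i : mindex d | refines i l) P i.

(* [psubst moebius_form] is the isomorphism R[Q] -> R[P] expanding each Moebius
   coordinate as a linear form, so this is [I] written in these coordinates. *)
Definition in_moebius (I : set {mpoly R[#|mindex d|]}) :
    set {mpoly R[#|qindex|]} :=
  [set f | I (psubst moebius_form f)].

Definition support (l : qindex) : {set 'I_n} := [set j | l j != None]%SET.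

Definition relevant (Sigma : {set {set 'I_n}}) (l : qindex) : bool :=
  support l \in Sigma.

(* [insub k] is [None] exactly for the last state k = (d j).-1. *)
Definition last_to_plus (i : mindex d) : qindex :=
  [ffun j => insub (val (i j)) : option 'I_(d j).-1].

Definition segre_ideal_q : set {mpoly R[#|qindex|]} :=
  psubst (fun i => pvar R (last_to_plus i)) @` @segre_ideal R _ d.

Definition eliminate_irrelevant (Sigma : {set {set 'I_n}})
    (J : set {mpoly R[#|qindex|]}) : set {mpoly R[#|qindex|]} :=
  ideal_generated [set f | J f /\ involves_only (relevant Sigma) f].

Definition L_space (Sigma : {set {set 'I_n}}) : set (tensor R d) :=
  [set P | forall s, s \in Sigma -> marginal P s = 0].

Definition relevant_index (Sigma : {set {set 'I_n}}) :=
  {l : qindex | relevant Sigma l}.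

Definition relevant_proj (Sigma : {set {set 'I_n}}) (P : tensor R d) :
    {ffun relevant_index Sigma -> R} :=
  [ffun l : relevant_index Sigma => moebius_coord P (val l)].

Definition monomial (lambda : R) (theta : forall j : 'I_n, 'I_(d j).-1 -> R)
    (l : qindex) : R :=
  lambda * \prod_(j : 'I_n) (if l j is Some k then theta j k else 1).

Definition monomial_image (Sigma : {set {set 'I_n}}) :
    set {ffun relevant_index Sigma -> R} :=
  [set x | exists lambda theta,
     x = [ffun l : relevant_index Sigma => monomial lambda theta (val l)]].

End MarginalIndependence.

(* Main.v *)
Require Import Defs.
From mathcomp Require Import all_boot all_order all_algebra.
From mathcomp Require Import boolp classical_sets reals.
From mathcomp Require Import mpoly.

Set Implicit Arguments.
Unset Strict Implicit.
Unset Printing Implicit Defensive.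

Import Order.TTheory GRing.Theory Num.Theory.

Local Open Scope classical_set_scope.
Local Open Scope ring_scope.

(** Write the independence conditions in the Moebius coordinates of a tensor.
    The marginal on a face [s] is determined by, and determines, the coordinates
    whose support lies in [s] ([eq_marginal]).  Once its vectors are normalized
    to have sum 1, a rank one tensor has coordinates of the form
    [lambda * \prod theta] ([moebius_product_monomial]).  Hence a distribution
    lies in the model exactly when its relevant coordinates have this form, with
    [lambda = 1], while its irrelevant coordinates are free ([model_sub_cone],
    [cone_simplex_model]).

    So the model spans, up to scaling, a piece of the set [independence_cone] of
    all tensors whose relevant coordinates are of the form
    [lambda * \prod theta].  This cone is the image of an affine space (the
    parameters [lambda], [theta] and the irrelevant coordinates) under a
    polynomial map that is monomial in Moebius coordinates.  The all-ones tensor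
    lies in the cone and is positive, so all points of the cone near it are
    positive and rescale into the model.  A homogeneous polynomial vanishing on
    the model therefore vanishes on an open part of the parameter space, hence
    on the whole cone ([vanishing_model_cone]).  It follows that the affine cone
    of the variety is the Zariski closure of [independence_cone]
    ([affine_cone_closure]).

    The ideal is then the kernel of a monomial substitution
    ([moebius_ideal_kernel]): it is toric, and prime because polynomial rings
    over a field are domains; primality gives both irreducibility statements.

    For the elimination, a polynomial is expanded in the monomials of the
    irrelevant variables.  These variables are free on the cone, so every
    coefficient of the expansion already vanishes on it ([elimination_generates]);
    the ideal is generated by its members in the relevant variables.  For such
    polynomials, vanishing on the cone and on the Segre cone are the same
    condition: setting the coordinates at + of the vectors to 1 specializes the
    Segre parametrization to the monomial one, and conversely dividing by these
    coordinates, when they are nonzero, brings a point of the Segre cone to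
    monomial form ([segre_vanishing_cylinder], [cylinder_vanishing_segre]).

    Throughout, identities between polynomials are obtained from identities
    between their values, and density arguments are reduced to univariate
    polynomials by restriction to curves. *)

(** * Univariate polynomials near a point *)

Section UnivariatePolynomials.
Variable R : realFieldType.

Lemma poly_eq0_itv (p : {poly R}) (e : R) :
  0 < e -> (forall t, 0 < t < e -> p.[t] = 0) -> p = 0.
Proof.
move=> e0 pe; pose rs := [seq e / k.+2%:R | k <- iota 0 (size p)].
apply: (@roots_geq_poly_eq0 _ _ rs); last by rewrite size_map size_iota.
- apply/allP => x /mapP[k _ ->]; apply/rootP/pe.
  by rewrite divr_gt0 ?ltr0n //= ltr_pdivrMr ?ltr0n // ltr_pMr // ltr1n.
- rewrite map_inj_uniq ?iota_uniq // => i j.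
  move=> /(mulfI (lt0r_neq0 e0)) /invr_inj /eqP.
  by rewrite eqr_nat => /eqP[].
Qed.

Lemma poly_eq0_horner (p : {poly R}) : (forall t, p.[t] = 0) -> p = 0.
Proof. by move=> p0; apply: (@poly_eq0_itv p 1) => // t _; apply: p0. Qed.

(** Writing [p] as [p.[0] + t * q], a bound for [q] on the unit interval
    replaces continuity. *)
Lemma horner_gt0_near1 (p : {poly R}) : 0 < p.[0] ->
  exists2 e : R, 0 < e & forall t, 0 < t < e -> 0 < p.[t].
Proof.
move=> p0; have : root (p - p.[0]%:P) 0.
  by rewrite rootE !hornerE subrr.
case/factor_theorem=> q pq; have [b bq] := poly_itv_bound q 0 1.
have b0 : 0 <= b by apply: le_trans (bq 0 _) => //; rewrite lexx ler01.
have b1 : 0 < b + 1 by rewrite ltr_wpDl.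
(* On [0, 1] the quotient [q] is at most [b] in absolute value, so that
   [p.[t]] differs from [p.[0]] by less than [t * (b + 1)]. *)
exists (Num.min 1 (p.[0] / (b + 1))); first by rewrite lt_min ltr01 divr_gt0.
move=> t /andP[t0]; rewrite lt_min ltr_pdivlMr // => /andP[t1 tb].
have -> : p.[t] = p.[0] + t * q.[t].
  have : (p - p.[0]%:P).[t] = (q * ('X - 0%:P)).[t] by rewrite pq.
  by rewrite !hornerE subr0 => /eqP; rewrite subr_eq => /eqP ->;
    rewrite addrC (mulrC t).
have : `|t * q.[t]| < p.[0].
  rewrite normrM gtr0_norm //; apply: le_lt_trans tb.
  rewrite ler_wpM2l ?(ltW t0) //; apply: (le_trans (bq t _)).
    by rewrite !ltW.
  by rewrite lerDl ler01.
by rewrite ltr_norml => /andP[+ _]; rewrite addrC -ltrBlDr sub0r.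
Qed.

Lemma horner_gt0_near (I : finType) (p : I -> {poly R}) :
  (forall i, 0 < (p i).[0]) ->
  exists2 e : R, 0 < e & forall t, 0 < t < e -> forall i, 0 < (p i).[t].
Proof.
move=> p0.
suff [e e0 pe] : exists2 e : R, 0 < e &
    forall t, 0 < t < e -> forall i, i \in enum I -> 0 < (p i).[t].
  by exists e => // t te i; apply: (pe t te); rewrite mem_enum.
elim: (enum I) => [|i s [e e0 pe]]; first by exists 1.
have [e' e'0 pe'] := horner_gt0_near1 (p0 i).
exists (Num.min e e'); first by rewrite lt_min e0.
move=> t /andP[t0]; rewrite lt_min => /andP[te te'] k.
rewrite inE => /predU1P[->|ks]; first by apply: pe'; rewrite t0.
by apply: pe => //; rewrite t0.
Qed.

End UnivariatePolynomials.

(** * Multivariate polynomials as functions *)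

Section PolynomialFunctions.
Variable R : realFieldType.

(** Restriction to a polynomial curve turns questions about multivariate
    polynomials into questions about univariate ones. *)
Lemma mpoly_along_curve k (f : {mpoly R[k]}) (h : 'I_k -> {poly R}) :
  exists p : {poly R}, forall t, p.[t] = f.@[fun i => (h i).[t]].
Proof.
exists (mmap (@polyC R) h f) => t.
rewrite mevalE horner_sum; apply: eq_bigr => m _.
rewrite hornerM hornerC /mmap1 horner_prod.
by congr (_ * _); apply: eq_bigr => i _; rewrite horner_exp.
Qed.

(** What makes Kronecker substitution injective on monomials with exponents
    below [B]. *)
Lemma digits_inj k (B : nat) (a b : 'I_k -> nat) :
  (forall i, a i < B)%N -> (forall i, b i < B)%N ->
  (\sum_i a i * B ^ i = \sum_i b i * B ^ i)%N -> a =1 b.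
Proof.
elim: k a b => [|k IH] a b aB bB; first by move=> _ [].
rewrite !big_ord_recl !expn0 !muln1.
pose S (c : 'I_k.+1 -> nat) := (\sum_(i < k) c (lift ord0 i) * B ^ i)%N.
have SE c : (\sum_(i < k) c (lift ord0 i) * B ^ lift ord0 i = S c * B)%N.
  rewrite big_distrl /=; apply: eq_bigr => i _.
  by rewrite /bump /= expnSr mulnA.
rewrite !SE => E.
have B0 : (0 < B)%N by apply: leq_ltn_trans (aB ord0).
have E0 : a ord0 = b ord0.
  have := congr1 (modn^~ B) E.
  by rewrite ![(_ + _ * B)%N]addnC !modnMDl !modn_small.
have ES : S a = S b.
  move/eqP: E; rewrite E0 eqn_add2l eqn_pmul2r //; by move/eqP.
have IHk := IH _ _ (fun i => aB (lift ord0 i)) (fun i => bB (lift ord0 i)) ES.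
by move=> i; case: (unliftP ord0 i) => [j|] ->.
Qed.

(** Kronecker substitution: on the curve [t |-> (t ^ (B ^ i))_i], with [B]
    larger than all exponents, distinct monomials become distinct powers of [t]. *)
Lemma mpoly_eq0_meval k (f : {mpoly R[k]}) : (forall v, f.@[v] = 0) -> f = 0.
Proof.
move=> f0; pose B := msize f.
pose w (m : 'X_{1..k}) := (\sum_(i < k) m i * B ^ i)%N.
have w_inj : {in msupp f &, injective w}.
  have dig m : m \in msupp f -> forall i, (m i < B)%N.
    move=> mf i; apply: leq_ltn_trans (msize_mdeg_lt mf).
    by rewrite mdegE (bigD1 i) //= leq_addr.
  move=> m m' mf m'f E; apply/mnmP.
  exact: (@digits_inj _ B m m' (dig _ mf) (dig _ m'f) E).
pose p := \sum_(m <- msupp f) f@_m *: 'X^(w m) : {poly R}.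
have p0 : p = 0.
  apply: poly_eq0_horner => t; rewrite -(f0 (fun i => t ^+ (B ^ i))).
  rewrite mevalE horner_sum; apply: eq_bigr => m _.
  rewrite hornerZ hornerXn; congr (_ * _).
  rewrite /w expr_sum; apply: eq_bigr => i _.
  by rewrite mulnC exprM.
apply/mpolyP => m; rewrite mcoeff0.
have [mf|/memN_msupp_eq0 //] := boolP (m \in msupp f).
have := congr1 (fun q : {poly R} => q`_(w m)) p0.
rewrite coef0 coef_sum (bigD1_seq m) ?msupp_uniq //= coefZ coefXn eqxx mulr1.
rewrite big_seq_cond big1 ?addr0 // => m' /andP[m'f neq].
rewrite coefZ coefXn; case: eqP => [E|]; last by rewrite mulr0.
by rewrite (w_inj _ _ mf m'f E) eqxx in neq.
Qed.

End PolynomialFunctions.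

(** * Vanishing ideals *)

Section PolynomialsOnPoints.
Variables (R : realType) (T : finType).
Implicit Types (f g : {mpoly R[#|T|]}) (P : {ffun T -> R}) (X : set {ffun T -> R}).

Lemma meval_psubst k (h : T -> {mpoly R[k]}) f v :
  (psubst h f).@[v] = peval f [ffun t => (h t).@[v]].
Proof.
rewrite /psubst comp_mpoly_meval; apply: meval_eq => i.
by rewrite tnth_mktuple ffunE.
Qed.

Lemma peval_psubst (T' : finType) (h : T -> {mpoly R[#|T'|]}) f
    (Q : {ffun T' -> R}) :
  peval (psubst h f) Q = peval f [ffun t => peval (h t) Q].
Proof. exact: meval_psubst. Qed.

Lemma peval_pvar t P : peval (pvar R t) P = P t.
Proof. by rewrite /peval mevalXU enum_rankK. Qed.

Lemma pevalM f g P : peval (f * g) P = peval f P * peval g P.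
Proof. exact: mevalM. Qed.

Lemma peval_sum (I : Type) (r : seq I) (A : pred I) F P :
  peval (\sum_(i <- r | A i) F i : {mpoly R[#|T|]}) P =
  \sum_(i <- r | A i) peval (F i) P.
Proof. exact: (raddf_sum (meval (fun i => P (enum_val i)))). Qed.

(** The field being infinite, this reduces every identity between substituted
    polynomials used below to a computation with points. *)
Lemma peval_inj f g : (forall P, peval f P = peval g P) -> f = g.
Proof.
move=> fg; apply/eqP; rewrite -subr_eq0; apply/eqP/mpoly_eq0_meval => v.
have /eqP := fg [ffun t => v (enum_rank t)].
rewrite /peval -subr_eq0 -mevalB => /eqP <-.
by apply: meval_eq => i; rewrite ffunE enum_valK.
Qed.

Lemma psubstM k (h : T -> {mpoly R[k]}) f g :
  psubst h (f * g) = psubst h f * psubst h g.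
Proof. exact: rmorphM. Qed.

Lemma psubst_kernel_prime k (h : T -> {mpoly R[k]}) :
  prime_ideal [set f | psubst h f = 0].
Proof.
split; first split.
- by rewrite inE /=; apply: rmorph0.
- rewrite notin_setE /= [psubst h 1]rmorph1; apply/eqP; exact: oner_neq0.
- move=> a u v; rewrite !inE /= => u0 v0.
  by rewrite [psubst _ _]rmorphD -[X in X + _]/(psubst h (a * u))
    psubstM u0 mulr0 add0r.
- move=> u v; rewrite !inE /= psubstM => /eqP.
  by rewrite mulf_eq0 => /orP[] /eqP uv; apply/orP; [left|right]; rewrite inE.
Qed.

Lemma peval_along_curve f (h : T -> {poly R}) :
  exists p : {poly R}, forall t, p.[t] = peval f [ffun i => (h i).[t]].
Proof.
have [p hp] := mpoly_along_curve f (fun i => h (enum_val i)).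
by exists p => t; rewrite hp; apply: meval_eq => i; rewrite ffunE.
Qed.

Lemma peval_scale k f c P : f \is k.-homog ->
  peval f [ffun t => c * P t] = c ^+ k * peval f P.
Proof.
move=> /dhomogP hf; rewrite /peval !mevalE mulr_sumr.
rewrite !big_seq; apply: eq_bigr => m /hf mk.
rewrite mulrCA; congr (_ * _).
under eq_bigr do rewrite ffunE exprMn.
by rewrite big_split /= -expr_sum -mdegE mk.
Qed.

(** Along the line through a point [P] of [X] and the origin, [f] restricts to
    a univariate polynomial whose coefficients are the values at [P] of the
    homogeneous parts of [f]. *)
Lemma vanishing_homog_parts X f k :
  (forall c P, X P -> X [ffun t => c * P t]) ->
  vanishing X f -> vanishing X (pihomog mdeg k f).
Proof.
move=> Xs Xf P XP.
pose p := \poly_(i < msize f) peval (pihomog mdeg i f) P.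
have p0 : p = 0.
  apply: poly_eq0_horner => t; apply: etrans (Xf _ (Xs t P XP)).
  rewrite horner_poly.
  rewrite [in RHS](pihomog_partitionE (leqnn (msize f))) peval_sum.
  by apply: eq_bigr => i _; rewrite mulrC (peval_scale _ _ (pihomogP _ _ _)).
have [kf|fk] := ltnP k (msize f).
  by have := congr1 (fun q : {poly R} => q`_k) p0; rewrite coef_poly kf coef0.
rewrite pihomogE big_seq_cond big1 ?/peval ?meval0 // => m /andP[mf /eqP mk].
by have := msize_mdeg_lt mf; rewrite mk ltnNge fk.
Qed.

Lemma vanishing_homogeneous X f :
  (forall c P, X P -> X [ffun t => c * P t]) ->
  vanishing X f -> forall Q,
  (forall g, vanishing X g -> homogeneous g -> peval g Q = 0) -> peval f Q = 0.
Proof.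
move=> Xs Xf Q hQ; rewrite (pihomog_partitionE (leqnn (msize f))) peval_sum.
apply: big1 => i _; apply: hQ; first exact: vanishing_homog_parts.
by exists i; apply: pihomogP.
Qed.

Lemma vanishing_zariski_closure X :
  vanishing (zariski_closure X) = vanishing X.
Proof.
apply/seteqP; split=> f fX P XP; first by apply: fX => g; apply.
exact: XP.
Qed.

Lemma ideal_generated_min X G :
  G `<=` vanishing X -> ideal_generated G `<=` vanishing X.
Proof.
move=> GX f [s sG ->] P XP; rewrite peval_sum big_seq big1 // => x xs.
by rewrite pevalM (GX _ (sG x xs) _ XP) mulr0.
Qed.

End PolynomialsOnPoints.

(** * Sums of products over multi-indices *)

Section DependentProducts.
Variables (R : comRingType) (I : finType) (T_ : I -> finType).

Lemma sum_dffun_prod (F : forall i, T_ i -> R) :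
  \sum_(f : {dffun forall i, T_ i}) \prod_i F i (f i) = \prod_i \sum_x F i x.
Proof.
rewrite (reindex (@dffun_of_fprod I T_)) /=; last exact/onW_bij/dffun_of_fprod_bij.
transitivity (\sum_(t : fprod T_) \prod_(i in I) [ffun x => F i x] (t i)).
  by apply: eq_bigr => t _; apply: eq_bigr => i _; rewrite !ffunE.
rewrite big_fprod -(bigA_distr_big_dep (fun i => [pred j | tag j == i])
  (fun i => untag 0 [ffun x => F i x])).
apply: eq_bigr => i _; rewrite -(big_tag (fun i => [ffun x => F i x])).
by apply: eq_bigr => x _; rewrite ffunE.
Qed.

Lemma natr_forall (A : pred I) : ([forall i, A i])%:R = \prod_i (A i)%:R :> R.
Proof.
have [/forallP At|] := boolP [forall i, A i].
  by rewrite big1 // => i _; rewrite At.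
by move=> /forallPn[i /negbTE Ai]; rewrite (bigD1 i) //= Ai mul0r.
Qed.

(** Every sum over multi-indices below ranges over a box defined coordinate
    by coordinate, so that sums of product tensors factor. *)
Lemma sum_dffun_prod_cond (A : forall i, pred (T_ i)) (F : forall i, T_ i -> R) :
  \sum_(f : {dffun forall i, T_ i} | [forall i, A i (f i)]) \prod_i F i (f i) =
  \prod_i \sum_(x | A i x) F i x.
Proof.
rewrite big_mkcond /=.
under [RHS]eq_bigr do rewrite big_mkcond /=.
rewrite -(sum_dffun_prod (fun i x => if A i x then F i x else 0)).
apply: eq_bigr => f _; have := natr_forall (fun i => A i (f i)).
have [/forallP At _|/forallPn[i /negbTE Ai] _] := boolP [forall i, A i (f i)].
  by apply: eq_bigr => i _; rewrite At.
by rewrite (bigD1 i) //= Ai mul0r.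
Qed.

End DependentProducts.

(** * The states of a single index *)

Lemma sum_option (R : nmodType) (T : finType) (A : pred (option T)) (F : option T -> R) :
  \sum_(o | A o) F o =
  (if A None then F None else 0) + \sum_(x | A (Some x)) F (Some x).
Proof.
rewrite big_mkcond (bigD1 None) //=; congr (_ + _).
rewrite (reindex_omap Some id) => [|[]//].
by rewrite -big_mkcondr; apply: eq_bigl => x; rewrite /= eqxx.
Qed.

Section States.
Variables (m : nat) (m_gt0 : (0 < m)%N).

Lemma last_state_subproof : (m.-1 < m)%N. Proof. by rewrite prednK. Qed.

Definition last_state : 'I_m := Ordinal last_state_subproof.

Definition widen_state (k : 'I_m.-1) : 'I_m := widen_ord (leq_pred m) k.

Definition state_matches (o : option 'I_m.-1) (x : 'I_m) : bool :=
  if o is Some k then val x == val k else true.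

Lemma widen_state_neq_last k : (widen_state k == last_state) = false.
Proof. by rewrite -val_eqE /= ltn_eqF. Qed.

(** The two ways in which [insub] reads a state as an element of
    [option 'I_m.-1], with [None] for the last state. *)
Variant state_spec (x : 'I_m) : option 'I_m.-1 -> Type :=
| StateWiden k of x = widen_state k : state_spec x (Some k)
| StateLast of x = last_state : state_spec x None.

Lemma stateP (x : 'I_m) : state_spec x (insub (val x)).
Proof.
case: insubP => [k _ kx|]; first by constructor; apply: val_inj; rewrite /= -kx.
rewrite -leqNgt => mx; constructor; apply: val_inj => /=.
by apply/eqP; rewrite eqn_leq mx andbT -ltnS prednK.
Qed.

Lemma sum_states (R : nmodType) (F : 'I_m -> R) :
  \sum_x F x = \sum_k F (widen_state k) + F last_state.
Proof.
rewrite /last_state /widen_state.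
move: (leq_pred m) last_state_subproof F; case: m m_gt0 => //= m' _ le_m lt_m F.
rewrite big_ord_recr /=; congr (_ + F _); last exact: val_inj.
by apply: eq_bigr => k _; congr F; apply: val_inj.
Qed.

(** The basis of [R ^ m] dual to the Moebius functionals of one index, which
    are the total sum and the entries at all states but the last: the dual of
    the total sum is concentrated at the last state, and the dual of an entry is
    corrected there so that it sums to zero. *)
Definition dual_vector (R : pzRingType) (o : option 'I_m.-1) (x : 'I_m) : R :=
  if o is Some k then (x == widen_state k)%:R - (x == last_state)%:R
  else (x == last_state)%:R.

Lemma sum_dual_vector (R : pzRingType) (o : option 'I_m.-1) :
  \sum_x dual_vector R o x = (o == None)%:R.
Proof.
have one (y : 'I_m) : \sum_x (x == y)%:R = 1 :> R.
  by rewrite (bigD1 y) //= eqxx big1 ?addr0 // => x /negbTE ->.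
by case: o => [k|] /=; rewrite ?sumrB !one ?subrr.
Qed.

Lemma dual_vector_widen (R : pzRingType) (o : option 'I_m.-1) k :
  dual_vector R o (widen_state k) = (o == Some k)%:R.
Proof.
rewrite /dual_vector; case: o => [k'|]; rewrite widen_state_neq_last //.
by rewrite subr0 -val_eqE /= eq_sym.
Qed.

(** The resolution of the identity by the Moebius functionals and their dual
    basis, evaluated at the unit vector of [y]. *)
Lemma dual_vector_resolution (R : pzRingType) (x y : 'I_m) :
  \sum_(o | state_matches o y) dual_vector R o x = (x == y)%:R.
Proof.
rewrite sum_option /=; case: (stateP y) => [k ->|->] {y}.
  rewrite (big_pred1 k) /=; last by move=> k1; rewrite eq_sym.
  by rewrite addrC subrK.
by rewrite big_pred0 ?addr0 // => k; rewrite gtn_eqF /=.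
Qed.

End States.

(** * Moebius coordinates and marginals *)

Section MoebiusCoordinates.
Variables (R : realType) (n : nat) (d : 'I_n -> nat).
Hypothesis d_gt0 : forall j, (0 < d j)%N.
Implicit Types (P : tensor R d) (l : qindex d) (s : {set 'I_n}).

Definition product_tensor (c : R) (v : forall j, 'I_(d j) -> R) : tensor R d :=
  [ffun i : mindex d => c * \prod_j v j (i j)].

Lemma product_tensorE c v i : product_tensor c v i = c * \prod_j v j (i j).
Proof. by rewrite /product_tensor ffunE. Qed.

Lemma moebius_product c v l :
  moebius_coord (product_tensor c v) l =
  c * \prod_j (if l j is Some k then v j (widen_state k) else \sum_x v j x).
Proof.
rewrite /moebius_coord; under [LHS]eq_bigr do rewrite product_tensorE.
rewrite -mulr_sumr; congr (_ * _).
rewrite (sum_dffun_prod_cond (fun j => state_matches (l j)) v).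
apply: eq_bigr => j _; rewrite /state_matches; case: (l j) => [k|//].
by rewrite (big_pred1 (widen_state k)).
Qed.

Lemma marginal_product c v s a :
  marginal (product_tensor c v) s a =
  c * \prod_(j | j \notin s) (\sum_x v j x) * \prod_j v (val j) (a j).
Proof.
rewrite ffunE; under [LHS]eq_bigr do rewrite product_tensorE.
rewrite -mulr_sumr -mulrA; congr (_ * _).
pose A j (x : 'I_(d j)) :=
  [forall j' : {j | j \in s}, (val j' == j) ==> (val x == val (a j'))].
have Aval (j' : {j | j \in s}) : A (val j') =1 pred1 (a j').
  move=> x; apply/forallP/eqP => [/(_ j')|-> j''].
    by rewrite eqxx => /eqP/val_inj.
  by apply/implyP => /eqP/val_inj->.
transitivity (\sum_(i : mindex d | [forall j, A j (i j)]) \prod_j v j (i j)).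
  apply: eq_bigl => i; apply/forallP/forallP => [h j|h j'].
    apply/forallP => j'; apply/implyP => /eqP jj'.
    by have := h j'; rewrite -val_eqE -jj'.
  by have := h (val j'); rewrite Aval.
rewrite sum_dffun_prod_cond (bigID (fun j => j \in s)) /= mulrC; congr (_ * _).
  apply: eq_bigr => j js; apply: eq_bigl => x.
  by apply/forallP => j'; apply/implyP => /eqP jj'; rewrite -jj' (valP j') in js.
rewrite (big_sub (mem s)); apply: eq_bigr => j _.
by rewrite (eq_bigl _ _ (Aval j)) big_pred1_eq.
Qed.

(** Moebius coordinates are tensor products of the functionals of each index,
    so the dual basis consists of tensor products of [dual_vector]. *)
Definition dual_tensor l : tensor R d :=
  product_tensor 1 (fun j => dual_vector (d_gt0 j) R (l j)).

Lemma moebius_dual l l' : moebius_coord (dual_tensor l) l' = (l == l')%:R.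
Proof.
rewrite moebius_product mul1r.
have -> : (l == l') = [forall j, l j == l' j].
  by apply/eqP/eqfunP => [->//|/ffunP].
rewrite natr_forall; apply: eq_bigr => j _.
by case: (l' j) => [k|]; rewrite ?dual_vector_widen ?sum_dual_vector.
Qed.

(** The tensor product over all indices of [dual_vector_resolution]; this
    plays the part of inclusion-exclusion. *)
Lemma moebius_inversion P :
  P = \sum_l [ffun i => moebius_coord P l * dual_tensor l i].
Proof.
apply/ffunP => i; rewrite sum_ffunE.
under [RHS]eq_bigr do rewrite ffunE.
transitivity (\sum_i' P i' * (i == i')%:R).
  rewrite (bigD1 i) //= eqxx mulr1 big1 ?addr0 // => i' /negbTE.
  by rewrite eq_sym => ->; rewrite mulr0.
under [RHS]eq_bigr do rewrite mulr_suml.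
rewrite (exchange_big_dep predT) //=; apply: eq_bigr => i' _.
rewrite -mulr_sumr; congr (_ * _).
under [RHS]eq_bigr do rewrite product_tensorE mul1r.
rewrite (sum_dffun_prod_cond (fun j o => state_matches o (i' j))
  (fun j o => dual_vector (d_gt0 j) R o (i j))).
under [RHS]eq_bigr do rewrite dual_vector_resolution.
rewrite -natr_forall; congr ((nat_of_bool _)%:R).
by apply/eqP/eqfunP => [->//|/ffunP].
Qed.

Definition tensor_of_moebius (q : qindex d -> R) : tensor R d :=
  [ffun i => \sum_l q l * dual_tensor l i].

Lemma tensor_of_moebiusK q : moebius_coord (tensor_of_moebius q) =1 q.
Proof.
move=> l; rewrite /moebius_coord; under [LHS]eq_bigr do rewrite ffunE.
rewrite exchange_big /=; under [LHS]eq_bigr do rewrite -mulr_sumr.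
rewrite (bigD1 l) //= [X in _ * X]moebius_dual eqxx mulr1.
rewrite big1 ?addr0 // => l' /negbTE ll'.
by rewrite [X in _ * X]moebius_dual ll' mulr0.
Qed.

Lemma moebius_coordK P : tensor_of_moebius (moebius_coord P) = P.
Proof.
rewrite [RHS]moebius_inversion; apply/ffunP => i.
by rewrite sum_ffunE ffunE; apply: eq_bigr => l _; rewrite [RHS]ffunE.
Qed.

(** Some factor of the dual tensor outside [s] sums to zero. *)
Lemma marginal_dual l s a : ~~ (Defs.support l \subset s) ->
  marginal (dual_tensor l) s a = 0.
Proof.
case/subsetPn => j; rewrite inE => lj js.
rewrite marginal_product (bigD1 j) //= sum_dual_vector (negbTE lj).
by rewrite mul0r mulr0 mul0r.
Qed.

Lemma marginal_expansion P s a :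
  marginal P s a =
  \sum_(l | Defs.support l \subset s) moebius_coord P l * marginal (dual_tensor l) s a.
Proof.
rewrite [LHS]ffunE; under [LHS]eq_bigr do rewrite -{1}[P]moebius_coordK ffunE.
rewrite exchange_big /= [RHS]big_mkcond /=; apply: eq_bigr => l _.
rewrite -mulr_sumr; case: ifPn => [_|ls]; first by rewrite [marginal _ _ a]ffunE.
by have := marginal_dual a ls; rewrite ffunE => ->; rewrite mulr0.
Qed.

Lemma moebius_of_marginal P l s : Defs.support l \subset s ->
  moebius_coord P l =
  \sum_(a : mindex (fun j : {j | j \in s} => d (val j)) |
        [forall j : {j | j \in s}, state_matches (l (val j)) (a j)])
    marginal P s a.
Proof.
move=> ls; pose r (i : mindex d) : mindex (fun j : {j | j \in s} => d (val j)) :=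
  [ffun j => i (val j)].
rewrite /moebius_coord.
rewrite (partition_big r
  (fun a => [forall j : {j | j \in s}, state_matches (l (val j)) (a j)])); last first.
  by move=> i /forallP il; apply/forallP => j; rewrite ffunE; apply: il.
apply: eq_bigr => a /forallP la; rewrite ffunE; apply: eq_bigl => i.
have -> : (r i == a) = [forall j : {j | j \in s}, i (val j) == a j].
  by apply/eqP/eqfunP => [<- j|ia]; [rewrite ffunE | apply/ffunP => j; rewrite ffunE].
rewrite andb_idl // => /eqfunP ia; apply/forallP => j.
case lj: (l j) => [k|//].
have js : j \in s by apply: (fintype.subsetP ls); rewrite inE lj.
by have := la (Sub j js); rewrite -ia SubK lj.
Qed.

(** From left to right, a coordinate supported in [s] is a sum of entries of
    the marginal; from right to left, the other coordinates do not contribute to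
    the marginal since their dual tensors have zero marginal. *)
Lemma eq_marginal P P' s :
  marginal P s = marginal P' s <->
  forall l, Defs.support l \subset s -> moebius_coord P l = moebius_coord P' l.
Proof.
split=> [E l ls|E]; first by rewrite !(moebius_of_marginal _ ls) E.
apply/ffunP => a; rewrite !marginal_expansion.
by apply: eq_bigr => l /E ->.
Qed.

Lemma moebius_coord0 l : moebius_coord (0 : tensor R d) l = 0.
Proof. by apply: big1 => i _; rewrite ffunE. Qed.

Lemma L_space_moebius (Sigma : {set {set 'I_n}}) :
  simplicial_complex Sigma ->
  @L_space R n d Sigma = [set P | relevant_proj Sigma P = 0].
Proof.
move=> cplx; apply/seteqP; split=> P.
- move=> LP; apply/ffunP => l; rewrite !ffunE.
  have [/(_ _ _ (subxx _)) -> //] := eq_marginal P 0 (Defs.support (val l)).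
    by rewrite moebius_coord0.
  rewrite (LP _ (valP l)); apply/ffunP => a; rewrite !ffunE big1 // => i _.
  by rewrite ffunE.
- move=> /= P0 s sS.
  transitivity (marginal (0 : tensor R d) s); last first.
    by apply/ffunP => a; rewrite !ffunE big1 // => i _; rewrite ffunE.
  apply/eq_marginal => l ls; rewrite moebius_coord0.
  move/ffunP/(_ (Sub l (cplx _ _ sS ls))): P0.
  by rewrite !ffunE SubK.
Qed.

End MoebiusCoordinates.

(** * The cone over the independence model *)

Section IndependenceCone.
Variables (R : realType) (n : nat) (d : 'I_n -> nat).
Hypothesis d_gt0 : forall j, (0 < d j)%N.
Variable Sigma : {set {set 'I_n}}.
Implicit Types (P : tensor R d) (l : qindex d) (s : {set 'I_n}).

(** The candidate for a dense part of the affine cone of the variety: the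
    relevant coordinates are parametrized, the irrelevant ones are free. *)
Definition independence_cone : set (tensor R d) :=
  [set P | exists lambda theta, forall l, relevant Sigma l ->
     moebius_coord P l = monomial lambda theta l].

Lemma moebius_total P : moebius_coord P [ffun=> None] = \sum_i P i.
Proof.
by apply: eq_bigl => i; apply/forallP => j; rewrite ffunE.
Qed.

Lemma support_total : Defs.support ([ffun=> None] : qindex d) = finset.set0.
Proof. by apply/setP => j; rewrite !inE ffunE eqxx. Qed.

(** The index whose Moebius coordinate is the entry [k] of the marginal on
    the single vertex [j]. *)
Definition single_index j (k : 'I_(d j).-1) : qindex d :=
  finfun (dfwith (fun j => None : option 'I_(d j).-1) (Some k)).

Lemma single_indexE j k : @single_index j k j = Some k.
Proof. by rewrite ffunE dfwith_in. Qed.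

Lemma single_index_out j k (j' : 'I_n) : j' != j -> @single_index j k j' = None.
Proof. by move=> jj'; rewrite ffunE dfwith_out // eq_sym. Qed.

Lemma support_single j k : Defs.support (@single_index j k) = finset.set1 j.
Proof.
apply/setP => j'; rewrite !inE; have [->|jj'] := eqVneq j' j.
  by rewrite single_indexE.
by rewrite single_index_out.
Qed.

Lemma monomial_single lambda (theta : forall j, 'I_(d j).-1 -> R) j k :
  monomial lambda theta (@single_index j k) = lambda * theta j k.
Proof.
rewrite /monomial (bigD1 j) //= single_indexE big1 ?mulr1 // => j' jj'.
by rewrite single_index_out.
Qed.

(** Normalizing the vectors of a rank one tensor to have sum 1 brings its
    Moebius coordinates to monomial form. *)
Lemma moebius_product_monomial c (v : forall j, 'I_(d j) -> R) l :
  (forall j, \sum_x v j x != 0) ->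
  moebius_coord (product_tensor c v) l =
  monomial (c * \prod_j \sum_x v j x)
    (fun j k => v j (widen_state k) / \sum_x v j x) l.
Proof.
move=> V0; rewrite moebius_product /monomial -mulrA -big_split /=.
congr (_ * _); apply: eq_bigr => j _.
by case: (l j) => [k|]; rewrite ?mulr1 // mulrC divfK ?V0.
Qed.

Lemma ones_in_cone : independence_cone (product_tensor 1 (fun _ _ => 1)).
Proof.
eexists; eexists => l _; rewrite moebius_product_monomial // => j.
by rewrite sumr_const card_ord pnatr_eq0 -lt0n.
Qed.

(** Outside [s] a unit vector is used, which sums to 1. *)
Lemma rank_le1_marginal s (Q : tensor R (fun j : {j | j \in s} => d (val j))) :
  rank_le1 Q -> exists c v, Q = marginal (product_tensor c v) s.
Proof.
case=> c [v Qv].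
pose w j (x : 'I_(d j)) := match boolP (j \in s) with
  | AltTrue js => v (exist _ j js) x
  | AltFalse _ => (x == last_state (d_gt0 j))%:R end.
exists c, w; apply/ffunP => a; rewrite marginal_product Qv.
rewrite [X in _ * X * _]big1 ?mulr1 => [|j js].
  congr (_ * _); apply: eq_bigr => -[j js] _; rewrite /w /=.
  by case: {-}_ / boolP => [js'|]; [rewrite (bool_irrelevance js js')|rewrite js].
rewrite (bigD1 (last_state (d_gt0 j))) //= big1 ?addr0 => [|x].
  by rewrite /w; case: {-}_ / boolP => [js'|_]; [rewrite js' in js|rewrite eqxx].
by rewrite /w; case: {-}_ / boolP => [js'|_ /negbTE->//]; rewrite js' in js.
Qed.

(** The rank one tensor whose vectors have entries [theta] at the first states
    and sum 1 has the same coordinates on the faces contained in [s], hence the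
    same marginal on [s]. *)
Lemma rank_le1_cone_marginal P s :
  simplicial_complex Sigma -> s \in Sigma -> independence_cone P ->
  rank_le1 (marginal P s).
Proof.
move=> cplx sS [lambda [theta Pm]].
pose v j (x : 'I_(d j)) : R :=
  if insub (val x) is Some k then theta j k else 1 - \sum_k theta j k.
have v_widen j k : v j (widen_state k) = theta j k.
  by rewrite /v /= insubT //= => lt_k; congr theta; apply: val_inj.
have v_sum j : \sum_x v j x = 1.
  rewrite (sum_states (d_gt0 j)) (eq_bigr _ (fun k _ => v_widen j k)).
  by rewrite /v /= insubF ?ltnn // addrC subrK.
have -> : marginal P s = marginal (product_tensor lambda v) s.
  apply/(eq_marginal d_gt0) => l ls; rewrite Pm; last exact: cplx ls.
  rewrite moebius_product_monomial => [|j]; last by rewrite v_sum oner_neq0.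
  rewrite /monomial [in RHS]big1 ?mulr1 => [|j _]; last exact: v_sum.
  congr (_ * _); apply: eq_bigr => j _; case: (l j) => // k.
  by rewrite v_sum divr1 v_widen.
exists (lambda * \prod_(j | j \notin s) \sum_x v j x), (fun j => v (val j)).
by move=> a; rewrite marginal_product.
Qed.

Lemma cone_simplex_model P :
  simplicial_complex Sigma -> independence_cone P -> simplex P ->
  independence_model Sigma P.
Proof.
move=> cplx coneP simP; split=> // s sS; split; last first.
  exact: rank_le1_cone_marginal.
move=> P0; have : marginal P s = marginal (0 : tensor R d) s.
  by rewrite P0; apply/ffunP => a; rewrite !ffunE big1 // => i _; rewrite ffunE.
move/(eq_marginal d_gt0)/(_ [ffun=> None]).
rewrite support_total finset.sub0set moebius_coord0 moebius_total simP.2 => /(_ isT).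
by apply/eqP; rewrite oner_eq0.
Qed.

(** The parameters must not depend on the face: they are read off from the
    marginals on single vertices, which the marginal on any face containing the
    vertex determines.  The total mass 1 gives [lambda = 1] and makes the sums
    of the vectors nonzero. *)
Lemma model_sub_cone : independence_model Sigma `<=` independence_cone.
Proof.
move=> P [[_ P1] Prank].
exists 1, (fun j k => moebius_coord P (@single_index j k)) => l lS.
have [_ /rank_le1_marginal[c [v Pv]]] := Prank _ lS.
move/(eq_marginal d_gt0): Pv => Pv.
have cV : c * \prod_j \sum_x v j x = 1.
  rewrite -[RHS]P1 -moebius_total Pv ?support_total ?finset.sub0set // moebius_product.
  by congr (_ * _); apply: eq_bigr => j _; rewrite ffunE.
have V0 j : \sum_x v j x != 0.
  apply/eqP => V0; move/eqP: cV; rewrite (bigD1 j) //= V0 mul0r mulr0.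
  by rewrite eq_sym oner_eq0.
rewrite Pv // moebius_product_monomial // cV /monomial; congr (_ * _).
apply: eq_bigr => j _; case lj: (l j) => [k|//].
rewrite Pv ?support_single ?finset.sub1set ?inE ?lj //.
by rewrite moebius_product_monomial // cV monomial_single mul1r.
Qed.

Lemma cone_scale c P : independence_cone P ->
  independence_cone [ffun i => c * P i].
Proof.
case=> lambda [theta Pm]; exists (c * lambda), theta => l lS.
rewrite /moebius_coord; under [LHS]eq_bigr do rewrite ffunE.
by rewrite -mulr_sumr [X in _ * X]Pm // /monomial mulrA.
Qed.

(** [None] stands for [lambda], the left summand for the [theta j k], and the
    right summand for the values of the irrelevant coordinates. *)
Definition cone_parameter : finType :=
  option ({j : 'I_n & 'I_(d j).-1} + qindex d)%type.

Definition theta_parameter j (k : 'I_(d j).-1) : cone_parameter :=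
  Some (inl (Tagged (fun j => 'I_(d j).-1) k)).

Definition cone_exponent l : 'X_{1..#|cone_parameter|} :=
  if relevant Sigma l then
    (U_(enum_rank (None : cone_parameter)) +
     \sum_j (if l j is Some k then U_(enum_rank (theta_parameter k)) else 0))%MM
  else U_(enum_rank (Some (inr l) : cone_parameter))%MM.

Definition cone_point (u : {ffun cone_parameter -> R}) l : R :=
  if relevant Sigma l
  then monomial (u None) (fun j k => u (theta_parameter k)) l
  else u (Some (inr l)).

Lemma peval_cone_exponent u l : peval 'X_[cone_exponent l] u = cone_point u l.
Proof.
rewrite /cone_exponent /cone_point; case: ifP => _; last exact: peval_pvar.
rewrite mpolyXD pevalM [peval 'X__ _]peval_pvar /monomial; congr (_ * _).
rewrite (big_morph (fun m => peval 'X_[R, m] u) (op1 := *%R) (id1 := 1)).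
- apply: eq_bigr => j _; case: (l j) => [k|]; first exact: peval_pvar.
  by rewrite mpolyX0 /peval meval1.
- by move=> m m'; rewrite mpolyXD pevalM.
- by rewrite mpolyX0 /peval meval1.
Qed.

Definition cone_form (i : mindex d) : {mpoly R[#|cone_parameter|]} :=
  \sum_l (dual_tensor R d_gt0 l i) *: 'X_[cone_exponent l].

Definition cone_tensor u : tensor R d :=
  [ffun i => peval (cone_form i) u].

Lemma moebius_cone_tensor u l : moebius_coord (cone_tensor u) l = cone_point u l.
Proof.
rewrite -(tensor_of_moebiusK d_gt0 (cone_point u)); congr moebius_coord.
apply/ffunP => i; rewrite !ffunE /cone_form peval_sum; apply: eq_bigr => l' _.
by rewrite /peval mevalZ -peval_cone_exponent mulrC.
Qed.

Lemma moebius_inj P P' : (forall l, moebius_coord P l = moebius_coord P' l) -> P = P'.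
Proof.
move=> PP'; rewrite -[P](moebius_coordK d_gt0) -[P'](moebius_coordK d_gt0).
by apply/ffunP => i; rewrite !ffunE; apply: eq_bigr => l _; rewrite PP'.
Qed.

Lemma independence_coneE : independence_cone = range cone_tensor.
Proof.
apply/seteqP; split=> P; last first.
  case=> u _ <-; exists (u None), (fun j k => u (theta_parameter k)) => l lS.
  by rewrite moebius_cone_tensor /cone_point lS.
case=> lambda [theta Pm].
exists [ffun p => match p with
  | None => lambda
  | Some (inl jk) => theta (tag jk) (tagged jk)
  | Some (inr l) => moebius_coord P l end] => //.
apply: moebius_inj => l; rewrite moebius_cone_tensor /cone_point !ffunE.
case: ifP => // lS; rewrite Pm // /monomial; congr (_ * _).
by apply: eq_bigr => j _; case: (l j) => // k; rewrite ffunE.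
Qed.

(** A polynomial vanishes on the image of a polynomial map exactly when its
    pullback vanishes identically. *)
Lemma vanishing_coneE f :
  vanishing independence_cone f <-> psubst cone_form f = 0.
Proof.
rewrite independence_coneE; split=> [f0|f0 _ [u _ <-]].
  by apply: peval_inj => u; rewrite peval_psubst [RHS]meval0; apply: f0; exists u.
by have := peval_psubst cone_form f u; rewrite f0 [LHS]meval0.
Qed.

Lemma vanishing_cone_prime f g : vanishing independence_cone (f * g) ->
  vanishing independence_cone f \/ vanishing independence_cone g.
Proof.
rewrite !vanishing_coneE psubstM => /eqP.
by rewrite mulf_eq0 => /orP[] /eqP; [left|right].
Qed.

Lemma cone_positive_model P :
  simplicial_complex Sigma -> independence_cone P -> (forall i, 0 < P i) ->
  independence_model Sigma [ffun i => (\sum_i' P i')^-1 * P i] /\ 0 < \sum_i P i.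
Proof.
move=> cplx coneP Ppos.
have S0 : 0 < \sum_i P i.
  rewrite (bigD1 ([ffun j => last_state (d_gt0 j)] : mindex d)) //=.
  by rewrite ltr_wpDr // sumr_ge0 // => i _; apply: ltW.
split=> //; apply: cone_simplex_model => //; first exact: cone_scale.
split=> [i|]; first by rewrite ffunE mulr_ge0 ?invr_ge0 // ltW.
under eq_bigr do rewrite ffunE.
by rewrite -mulr_sumr mulVf ?gt_eqF.
Qed.

(** For a point of the cone, take the line in parameter space that joins the
    parameters of the all-ones tensor to those of the point.  Near its origin
    the tensors on the image curve are positive, so they are multiples of points
    of the model, where [f] vanishes by homogeneity; hence [f] vanishes on the
    whole curve. *)
Lemma vanishing_model_cone f : simplicial_complex Sigma -> homogeneous f ->
  vanishing (independence_model Sigma) f -> vanishing independence_cone f.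
Proof.
move=> cplx [k fk] f0; rewrite {1}independence_coneE => _ [u _ <-].
have [u0 _ u0E] : range cone_tensor (product_tensor 1 (fun _ _ => 1) : tensor R d).
  by rewrite -independence_coneE; apply: ones_in_cone.
pose ut (p : cone_parameter) : {poly R} := (u0 p)%:P + (u p - u0 p) *: 'X.
pose P t := cone_tensor [ffun p => (ut p).[t]].
have [h hP] : exists h : mindex d -> {poly R}, forall i t, (h i).[t] = P t i.
  apply: (@fin_all_exists _ _ (fun i p => forall t, p.[t] = P t i)) => i.
  have [p hp] := peval_along_curve (cone_form i) ut; exists p => t.
  by rewrite hp ffunE.
have {}hP t : [ffun i => (h i).[t]] = P t by apply/ffunP => i; rewrite ffunE.
have [p pf] := peval_along_curve f h.
have P0 : P 0 = product_tensor 1 (fun _ _ => 1).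
  by rewrite -u0E; congr cone_tensor; apply/ffunP => q; rewrite ffunE !hornerE.
have P1 : P 1 = cone_tensor u.
  by congr cone_tensor; apply/ffunP => q;
    rewrite ffunE /ut hornerD hornerC hornerZ hornerX mulr1 addrC subrK.
have [e e0 he] : exists2 e : R, 0 < e &
    forall t, 0 < t < e -> forall i, 0 < (h i).[t].
  apply: horner_gt0_near => i; move/ffunP/(_ i): (hP 0); rewrite ffunE => ->.
  by rewrite P0 product_tensorE big1 // mulr1.
suff p0 : p = 0 by rewrite -P1 -hP -pf p0 horner0.
apply: (poly_eq0_itv e0) => t te; rewrite pf hP.
have Ppos i : 0 < P t i by rewrite -hP ffunE; apply: he.
have coneP : independence_cone (P t) by rewrite independence_coneE; eexists.
have [modP S0] := cone_positive_model cplx coneP Ppos.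
set S := \sum_i _ in modP S0.
have -> : P t = [ffun i => S * [ffun i => S^-1 * P t i] i].
  by apply/ffunP => i; rewrite !ffunE mulVKf // gt_eqF.
by rewrite (peval_scale _ _ fk) f0 // mulr0.
Qed.

End IndependenceCone.

(** * Elimination of free variables *)

Section SeparatingVariables.
Variables (R : realType) (T : finType).
Implicit Types (f g : {mpoly R[#|T|]}) (A : pred T) (m : 'X_{1..#|T|}).

Lemma eq_peval_involves_only A f (P Q : {ffun T -> R}) :
  involves_only A f -> (forall t, A t -> P t = Q t) -> peval f P = peval f Q.
Proof.
move=> fA PQ; rewrite /peval !mevalE !big_seq; apply: eq_bigr => m mf.
congr (_ * _); apply: eq_bigr => i _.
have [->|mi] := eqVneq (m i) 0%N; first by rewrite !expr0.
by rewrite PQ // (fA m mf) // enum_valK.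
Qed.

Definition monomial_part A m : 'X_{1..#|T|} :=
  [multinom (if A (enum_val i) then m i else 0%N) | i < #|T|].

Lemma monomial_partE A m i :
  monomial_part A m i = if A (enum_val i) then m i else 0%N.
Proof. exact: mnmE. Qed.

Lemma monomial_part_split A m :
  'X_[R, m] = 'X_[monomial_part (predC A) m] * 'X_[monomial_part A m].
Proof.
rewrite -mpolyXD; congr 'X_[_]; apply/mnmP => i.
by rewrite mnmDE !monomial_partE /=; case: (A _); rewrite ?addn0.
Qed.

Lemma involves_only_part A (I : Type) (r : seq I) (B : pred I) (c : I -> R)
    (m : I -> 'X_{1..#|T|}) :
  involves_only A (\sum_(i <- r | B i) c i *: 'X_[monomial_part A (m i)]).
Proof.
move=> m' + t m't; apply: contraTT => At.
rewrite mcoeff_msupp negbK raddf_sum /=; apply/eqP/big1 => i _.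
rewrite mcoeffZ mcoeffX; case: eqP => [E|]; last by rewrite mulr0.
by rewrite -E monomial_partE enum_rankK (negbTE At) eqxx in m't.
Qed.

Definition part_coefficient A f m : {mpoly R[#|T|]} :=
  \sum_(m' <- msupp f | monomial_part (predC A) m' == m)
     f@_m' *: 'X_[monomial_part A m'].

Definition outer_parts A f : seq 'X_{1..#|T|} :=
  undup [seq monomial_part (predC A) m | m <- msupp f].

Lemma part_coefficient_sum A f :
  f = \sum_(m <- outer_parts A f) 'X_[m] * part_coefficient A f m.
Proof.
rewrite {1}[f]mpolyE.
under [RHS]eq_bigr do rewrite mulr_sumr big_mkcond /=.
rewrite exchange_big /= big_seq [RHS]big_seq; apply: eq_bigr => m mf.
rewrite (bigD1_seq (monomial_part (predC A) m)) ?undup_uniq //=; last first.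
  by rewrite mem_undup map_f.
rewrite eqxx big1 ?addr0 => [|m' /negbTE]; last by rewrite eq_sym => ->.
by rewrite (monomial_part_split A m) scalerAr.
Qed.

(** With the variables in [A] fixed at the values of [q], the polynomial [f]
    becomes the polynomial [g] in the other variables, whose coefficients are
    the values at [q] of the coefficients of [f].  As [g] vanishes identically,
    so do they. *)
Lemma vanishing_part_coefficient A f (q : {ffun T -> R}) :
  (forall Q : {ffun T -> R}, (forall t, A t -> Q t = q t) -> peval f Q = 0) ->
  forall m, m \in outer_parts A f -> peval (part_coefficient A f m) q = 0.
Proof.
move=> fq m mf.
pose g := \sum_(m <- outer_parts A f) peval (part_coefficient A f m) q *: 'X_[R, m].
have g0 : g = 0.
  apply: peval_inj => Q; rewrite [RHS]meval0.
  pose Q' : {ffun T -> R} := [ffun t => if A t then q t else Q t].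
  have Q'A t : A t -> Q' t = q t by rewrite ffunE => ->.
  rewrite -(fq Q' Q'A) [in RHS](part_coefficient_sum A f) !peval_sum.
  rewrite !big_seq; apply: eq_bigr => m'.
  rewrite mem_undup => /mapP[m1 _ ->].
  rewrite pevalM [LHS]mevalZ mulrC; congr (_ * _).
    apply: (@eq_peval_involves_only (predC A)) => [|t /= /negbTE At]; last first.
      by rewrite ffunE At.
    have := @involves_only_part (predC A) _ [:: m1] predT (fun=> 1) id.
    by rewrite big_seq1 scale1r.
  apply: (@eq_peval_involves_only A) => [|t At]; last by rewrite Q'A.
  exact: involves_only_part.
have := congr1 (fun g => g@_m) g0; rewrite mcoeff0 /g raddf_sum /=.
rewrite (bigD1_seq m) ?undup_uniq //= mcoeffZ mcoeffX eqxx mulr1.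
by rewrite big1 ?addr0 // => m' /negbTE m'm; rewrite mcoeffZ mcoeffX m'm mulr0.
Qed.

(** If membership in [X] constrains only the variables in [A], then [f] lies in
    the ideal generated by its own coefficients with respect to the other
    variables, and these still vanish on [X]. *)
Lemma elimination_generates A f (X : set {ffun T -> R}) :
  (forall q Q : {ffun T -> R}, X q -> (forall t, A t -> Q t = q t) -> X Q) ->
  vanishing X f ->
  ideal_generated [set g | vanishing X g /\ involves_only A g] f.
Proof.
move=> XA Xf.
exists [seq ('X_[m], part_coefficient A f m) | m <- outer_parts A f].
  move=> _ /mapP[m mf ->] /=; split; last exact: involves_only_part.
  move=> q Xq; apply: vanishing_part_coefficient mf => Q Qq.
  exact: Xf (XA _ _ Xq Qq).
by rewrite big_map -part_coefficient_sum.
Qed.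

End SeparatingVariables.

(** * The marginal independence variety *)

Section MarginalIndependenceVariety.
Variables (R : realType) (n : nat) (d : 'I_n -> nat).
Hypothesis d_gt0 : forall j, (0 < d j)%N.
Variable Sigma : {set {set 'I_n}}.
Hypothesis Sigma_cplx : simplicial_complex Sigma.

Local Notation model := (@independence_model R n d Sigma).
Local Notation cone := (@independence_cone R n d Sigma).
Local Notation M := (@independence_variety R n d Sigma).
Local Notation C := (affine_cone M).

Lemma zero_in_cone : cone 0.
Proof.
have := cone_scale 0 (ones_in_cone R d_gt0 Sigma); congr (cone _).
by apply/ffunP => i; rewrite !ffunE mul0r.
Qed.

Lemma model_neq0 : model !=set0.
Proof.
eexists; apply: (proj1 (cone_positive_model d_gt0 Sigma_cplx
  (ones_in_cone R d_gt0 Sigma) _)).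
by move=> i; rewrite product_tensorE big1 // mulr1.
Qed.

Lemma model_sub_variety : model `<=` M.
Proof.
move=> P modP; split=> [P0|f f0 _]; last exact: f0.
have [[_ +] _] := modP; rewrite P0 big1 => [/eqP|i _]; last by rewrite ffunE.
by rewrite eq_sym oner_eq0.
Qed.

Lemma variety_vanishing f P :
  homogeneous f -> vanishing cone f -> M P -> peval f P = 0.
Proof.
move=> fh f0 [_ PM]; apply: PM => // Q modQ.
exact: f0 (model_sub_cone d_gt0 modQ).
Qed.

(** The homogeneous polynomials vanishing on the model are those vanishing on
    the cone, and they suffice to cut out the closure of the latter because it
    is stable under scaling. *)
Lemma affine_cone_closure : C = zariski_closure cone.
Proof.
apply/seteqP; split=> P.
- move=> [MP|->] f f0; last exact/f0/zero_in_cone.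
  apply: (vanishing_homogeneous (@cone_scale _ _ _ Sigma) f0) => g g0 gh.
  exact: variety_vanishing.
- move=> cP; have [->|/eqP P0] := eqVneq P 0; first by right.
  left; split=> // f f0 fh; apply: cP.
  exact: (vanishing_model_cone d_gt0).
Qed.

Lemma vanishing_affine_cone : vanishing C = vanishing cone.
Proof. by rewrite affine_cone_closure vanishing_zariski_closure. Qed.

(** A point of the cone outside [A] and one outside [B] give two polynomials
    whose product vanishes on the cone although neither factor does. *)
Lemma irreducible_affine_cone : irreducible_for (@zariski_closed R (mindex d)) C.
Proof.
split=> [|A B [F ->] [G ->] CFG]; first by exists 0; right.
apply: contrapT => /not_orP[].
move=> /existsNP[P /not_implyP[CP /existsNP[f /not_implyP[Ff fP]]]].
move=> /existsNP[Q /not_implyP[CQ /existsNP[g /not_implyP[Gg gQ]]]].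
have fg0 : vanishing C (f * g).
  by move=> S /CFG [] SF; rewrite pevalM;
    [rewrite (SF f) // mul0r|rewrite (SF g) // mulr0].
rewrite vanishing_affine_cone in fg0.
have := vanishing_cone_prime d_gt0 fg0; rewrite -vanishing_affine_cone.
by case=> [/(_ P CP)/fP|/(_ Q CQ)/gQ].
Qed.

(** As for the affine cone, except that the product of the two separating
    polynomials is only known to vanish on the model; being homogeneous, it
    vanishes on the whole cone. *)
Lemma irreducible_variety : irreducible_for (@proj_closed R (mindex d)) M.
Proof.
split=> [|A B [F ->] [G ->] MFG].
  by have [P modP] := model_neq0; exists P; apply: model_sub_variety.
apply: contrapT => /not_orP[].
move=> /existsNP[P /not_implyP[MP /not_andP[/(_ MP.1)//|]]].
move=> /existsNP[f /not_implyP[Ff /not_implyP[fh fP]]].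
move=> /existsNP[Q /not_implyP[MQ /not_andP[/(_ MQ.1)//|]]].
move=> /existsNP[g /not_implyP[Gg /not_implyP[gh gQ]]].
have fgh : homogeneous (f * g).
  by have [k fk] := fh; have [k' gk'] := gh; exists (k + k')%N; apply: dhomogM.
have fg0 : vanishing model (f * g).
  move=> S /model_sub_variety /MFG [[_ SF]|[_ SG]]; rewrite pevalM.
    by rewrite (SF f) // mul0r.
  by rewrite (SG g) // mulr0.
have := vanishing_cone_prime d_gt0 (vanishing_model_cone d_gt0 Sigma_cplx fgh fg0).
by case=> /variety_vanishing h; [apply/fP/h|apply/gQ/h].
Qed.

(** The image of [independence_cone] in Moebius coordinates. *)
Definition monomial_cylinder : set {ffun qindex d -> R} :=
  [set q | exists lambda theta, forall l, relevant Sigma l ->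
     q l = monomial lambda theta l].

Lemma peval_moebius_form (P : tensor R d) l :
  peval (moebius_form R l) P = moebius_coord P l.
Proof. by rewrite peval_sum; apply: eq_bigr => i _; rewrite peval_pvar. Qed.

Lemma peval_moebius f (P : tensor R d) :
  peval (psubst (moebius_form R (d := d)) f) P =
  peval f [ffun l => moebius_coord P l].
Proof.
rewrite peval_psubst; congr peval.
by apply/ffunP => l; rewrite !ffunE peval_moebius_form.
Qed.

Lemma moebius_ideal : in_moebius (vanishing C) = vanishing monomial_cylinder.
Proof.
rewrite vanishing_affine_cone; apply/seteqP; split=> f f0.
- move=> q [lambda [theta qE]].
  have <- : [ffun l => moebius_coord (tensor_of_moebius d_gt0 q) l] = q.
    by apply/ffunP => l; rewrite ffunE tensor_of_moebiusK.
  rewrite -peval_moebius; apply: f0; exists lambda, theta => l lS.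
  by rewrite tensor_of_moebiusK qE.
- move=> P [lambda [theta PE]]; rewrite peval_moebius; apply: f0.
  by exists lambda, theta => l lS; rewrite ffunE PE.
Qed.

Lemma moebius_ideal_kernel :
  in_moebius (vanishing C) =
  [set f | psubst (fun l => 'X_[R, cone_exponent Sigma l]) f = 0].
Proof.
have pE f u : peval (psubst (fun l => 'X_[R, cone_exponent Sigma l]) f) u =
              peval (psubst (moebius_form R (d := d)) f) (cone_tensor d_gt0 Sigma u).
  rewrite peval_moebius peval_psubst; congr peval; apply/ffunP => l.
  by rewrite !ffunE moebius_cone_tensor peval_cone_exponent.
rewrite vanishing_affine_cone (independence_coneE R d_gt0).
apply/seteqP; split=> f /= f0.
- apply: peval_inj => u; rewrite [RHS]meval0 pE.
  by apply: f0; exists u.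
- by move=> _ [u _ <-]; rewrite -pE f0 [LHS]meval0.
Qed.

Lemma moebius_ideal_toric : toric_ideal (in_moebius (vanishing C)).
Proof.
rewrite moebius_ideal_kernel; split; first exact: psubst_kernel_prime.
by exists #|cone_parameter d|, (@cone_exponent n d Sigma).
Qed.

Definition plus_to_last (l : qindex d) : mindex d :=
  [ffun j => if l j is Some k then widen_state k else last_state (d_gt0 j)].

Lemma plus_to_lastK : cancel plus_to_last (@last_to_plus n d).
Proof.
move=> l; apply/ffunP => j; rewrite !ffunE; case: (l j) => [k|].
  by rewrite /= insubT //= => lt_k; congr Some; apply: val_inj.
by rewrite insubF //= ltnn.
Qed.

(** Rank one tensors with the last state renamed to +. *)
Definition segre_cone_q : set {ffun qindex d -> R} :=
  [set q : {ffun qindex d -> R} |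
     exists c (w : forall j, option 'I_(d j).-1 -> R),
     forall l : qindex d, q l = c * \prod_j w j (l j)].

(** Renaming the last states to + is a bijection of the indices, so it
    matches the vanishing ideals. *)
Lemma segre_ideal_qE : @segre_ideal_q R n d = vanishing segre_cone_q.
Proof.
apply/seteqP; split=> f.
- move=> [g g0 <-] q [c [w qE]]; rewrite peval_psubst; apply: g0.
  exists c, (fun j x => w j (insub (val x))) => i.
  rewrite ffunE peval_pvar qE; congr (_ * _); apply: eq_bigr => j _.
  by rewrite ffunE.
- move=> f0; exists (psubst (fun l => pvar R (plus_to_last l)) f).
    move=> P [c [v PE]]; rewrite peval_psubst; apply: f0.
    exists c, (fun j o => v j (if o is Some k then widen_state k
                               else last_state (d_gt0 j))) => l.
    rewrite ffunE peval_pvar PE; congr (_ * _).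
    by apply: eq_bigr => j _; rewrite ffunE.
  apply: peval_inj => q; rewrite !peval_psubst; congr peval.
  by apply/ffunP => l; rewrite !ffunE !peval_pvar ffunE peval_pvar plus_to_lastK.
Qed.

(** A Segre point whose vectors are nonzero at + is monomial with parameters
    [w j (Some k) / w j None].  In general the coordinates at + are moved to
    [w j None + t], which is nonzero for all but finitely many [t]; multiplying
    by the product of these polynomials in [t] takes care of the exceptions. *)
Lemma cylinder_vanishing_segre :
  vanishing monomial_cylinder `<=` vanishing segre_cone_q.
Proof.
move=> f f0 q [c [w qE]].
have nonzero_case (w' : forall j, option 'I_(d j).-1 -> R) :
    (forall j, w' j None != 0) ->
    peval f [ffun l : qindex d => c * \prod_j w' j (l j)] = 0.
  move=> w0; apply: f0; exists (c * \prod_j w' j None).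
  exists (fun j k => w' j (Some k) / w' j None) => l _.
  rewrite ffunE /monomial -mulrA -big_split; congr (_ * _).
  by apply: eq_bigr => j _; case: (l j) => [k|]; rewrite /= ?mulr1 // mulrC divfK.
pose W j o : {poly R} := (w j o)%:P + (o == None)%:R *: 'X.
pose h (l : qindex d) : {poly R} := c *: \prod_j W j (l j).
have hE t l : (h l).[t] = c * \prod_j (W j (l j)).[t].
  by rewrite hornerZ horner_prod.
have [p pE] := peval_along_curve f h.
have p0 : p * \prod_j W j None = 0.
  apply: poly_eq0_horner => t; rewrite hornerM horner_prod pE.
  have [/forallP W0|/forallPn[j /negPn/eqP Wj]] :=
      boolP [forall j, (W j None).[t] != 0]; last first.
    by rewrite (bigD1 j) //= Wj mul0r mulr0.
  under [X in peval f X]eq_ffun do rewrite hE.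
  by rewrite (nonzero_case (fun j o => (W j o).[t])) ?mul0r.
have {p0} p0 : p = 0.
  move/eqP: p0; rewrite mulf_eq0 => /orP[/eqP//|].
  rewrite prodf_seq_eq0 => /hasP[j _ /=].
  by rewrite /W eqxx scale1r addrC -size_poly_eq0 size_XaddC.
have <- : [ffun l => (h l).[0]] = q.
  apply/ffunP => l; rewrite ffunE hE qE; congr (_ * _).
  by apply: eq_bigr => j _; rewrite /W hornerD hornerC hornerZ hornerX mulr0 addr0.
by rewrite -pE p0 horner0.
Qed.

(** The relevant coordinates of a point of the cylinder are those of the Segre
    point with value 1 at +, and [f] depends on nothing else. *)
Lemma segre_vanishing_cylinder f :
  involves_only (relevant Sigma) f -> vanishing segre_cone_q f ->
  vanishing monomial_cylinder f.
Proof.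
move=> frel f0 q [lambda [theta qE]].
rewrite (eq_peval_involves_only (Q := [ffun l => monomial lambda theta l]) frel).
  apply: f0; exists lambda, (fun j o => if o is Some k then theta j k else 1) => l.
  by rewrite ffunE.
by move=> l lS; rewrite qE // ffunE.
Qed.

Lemma moebius_ideal_eliminate :
  in_moebius (vanishing C) = eliminate_irrelevant Sigma (@segre_ideal_q R n d).
Proof.
rewrite moebius_ideal segre_ideal_qE; apply/seteqP; split.
- move=> f f0; have [|s sG ->] := elimination_generates (A := relevant Sigma) _ f0.
    move=> q Q [lambda [theta qE]] Qq; exists lambda, theta => l lS.
    by rewrite Qq // qE.
  exists s => // x /sG[x0 xrel]; split=> //.
  exact: cylinder_vanishing_segre.
- apply: ideal_generated_min => f [f0 frel].
  exact: segre_vanishing_cylinder.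
Qed.

(** A polynomial in the relevant coordinates is pulled back along the
    projection.  In the other direction a point is lifted by giving the
    irrelevant coordinates the value 0, which is harmless as they are free. *)
Lemma relevant_proj_closure :
  [set relevant_proj Sigma P | P in C] =
    zariski_closure (@monomial_image R n d Sigma).
Proof.
rewrite affine_cone_closure.
apply/seteqP; split=> [_ [P CP <-] g g0|x xM].
- have pE (Q : tensor R d) : peval (psubst (fun l : relevant_index d Sigma =>
      moebius_form R (val l)) g) Q = peval g (relevant_proj Sigma Q).
    rewrite peval_psubst; congr peval.
    by apply/ffunP => l; rewrite !ffunE peval_moebius_form.
  rewrite -pE; apply: CP => Q [lambda [theta QE]]; rewrite pE; apply: g0.
  by exists lambda, theta; apply/ffunP => l; rewrite !ffunE QE // (valP l).
- pose ext (y : {ffun relevant_index d Sigma -> R}) : tensor R d :=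
    tensor_of_moebius d_gt0 (fun l => if insub l is Some l' then y l' else 0).
  have extK y l : moebius_coord (ext y) (val l) = y l.
    by rewrite tensor_of_moebiusK valK.
  exists (ext x); last by apply/ffunP => l; rewrite ffunE extK.
  move=> f f0.
  pose h i : {mpoly R[#|{: relevant_index d Sigma}|]} :=
    \sum_l dual_tensor R d_gt0 l i *: (if insub l is Some l' then pvar R l' else 0).
  have hE y : peval (psubst h f) y = peval f (ext y).
    rewrite peval_psubst; congr peval; apply/ffunP => i; rewrite !ffunE peval_sum.
    apply: eq_bigr => l _; rewrite /peval mevalZ mulrC; congr (_ * _).
    by case: insub => [l'|]; [apply: peval_pvar|apply: meval0].
  rewrite -hE; apply: xM => _ [lambda [theta ->]]; rewrite hE; apply: f0.
  exists lambda, theta => l lS.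
  by rewrite -[l]/(val (Sub l lS : relevant_index d Sigma)) extK ffunE.
Qed.

End MarginalIndependenceVariety.

Theorem theorem10 (R : realType) (n : nat) (d : 'I_n -> nat)
    (Sigma : {set {set 'I_n}})
    (n_ge1 : (1 <= n)%N) (d_gt0 : forall j, (0 < d j)%N)
    (Sigma_cplx : simplicial_complex Sigma)
    (Sigma_vert : forall j : 'I_n, [set j]%SET \in Sigma) :
  let M := @independence_variety R n d Sigma in
  let C := affine_cone M in
  let I := in_moebius (vanishing C) in
  [/\ irreducible_for (@proj_closed R (mindex d)) M
        /\ irreducible_for (@zariski_closed R (mindex d)) C,
      toric_ideal I,
      I = eliminate_irrelevant Sigma (@segre_ideal_q R n d),
      @L_space R n d Sigma = [set P | relevant_proj Sigma P = 0]
    & [set relevant_proj Sigma P | P in C] =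
        zariski_closure (@monomial_image R n d Sigma)].
Proof.
split.
- by split; [apply: irreducible_variety|apply: irreducible_affine_cone].
- exact: moebius_ideal_toric.
- exact: moebius_ideal_eliminate.
- exact: L_space_moebius.
- exact: relevant_proj_closure.
Qed.
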